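(* Let $M$ be an open oriented 3-manifold, homeomorphic to the interior of a compact 3-manifold $\overline M$ with nonempty boundary, and equipped with an ideal triangulation. Then for any abstract oscillating curves $\zeta,\zeta'$ in $M$, $$\omega(h(\zeta),h(\zeta'))=2\,\zeta\cdot\zeta',$$ where $\omega$ is the Neumann–Zagier symplectic form, $h$ is the combinatorial holonomy and $\zeta\cdot\zeta'$ is the intersection number.
   Context: **Triangulation and labels.** $M$ is obtained from oriented ideal tetrahedra $t_1,\dots,t_n$ (vertices removed) by gluing all faces in pairs by orientation-reversing maps, and truncating the ideal vertices decomposes $\overline M$ into truncated tetrahedra; the boundary components may have any genus. Label the edges of each $t_i$ by $a,b,c$ so that opposite edges have the same label and the three edges at each vertex are labelled $a,b,c$ in anticlockwise order viewed from outside. The truncated $t_i$ has four triangular faces $\Delta$ (one per ideal vertex) and four hexagonal faces $F$ (one per face of $t_i$). Corners of $\Delta$ are labelled $a,b,c$ by the edge of $t_i$ ending there; the side of $\Delta$ between corners $a,b$ is labelled $ab$, similarly $bc,ca$. A hexagon $F$ has three short sides (sides of triangles), which carry labels $ab,bc,ca$ (in clockwise order viewed from outside), alternating with three long sides (along edges of $t_i$). If $F$ is glued to $\widehat F$, the short side of $F$ labelled $k$ is glued to a short side of $\widehat F$ whose label is denoted $\widehat k$; because gluings reverse orientation, if $(k,l,m)$ is a cyclic permutation of $(ab,bc,ca)$ then $(\widehat k,\widehat l,\widehat m)$ is a cyclic permutation of $(ab,ca,bc)$. **Abstract oscillating curves.** There is an oriented enhanced train track on the Heegaard surface bounding the handlebody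 obtained from $\overline M$ by removing open tubular neighbourhoods of the ideal edges. Its oriented branches are: for each triangle $\Delta$, the branches $\gamma_{\Delta(a)},\gamma_{\Delta(b)},\gamma_{\Delta(c)}$ (running around the corners of $\Delta$) and $\gamma_{\Delta(ab)},\gamma_{\Delta(bc)},\gamma_{\Delta(ca)}$ (running out across the sides of $\Delta$); for each hexagon $F$ and distinct $k,l\in\{ab,bc,ca\}$, the branches $\gamma_{F(k)}$ (running to the short side $k$) and $\gamma_{F(k,l)}$ (starting near the short side $k$ and running along the long side towards the short side $l$). An abstract oscillating curve $\zeta=\sum_\gamma n_\gamma\gamma$ is an assignment of an integer $n_\gamma$ to each branch satisfying the following, where $n_\bullet$ abbreviates $n_{\gamma_\bullet}$: (1) for each triangle $\Delta$: $n_{\Delta(ab)}=n_{\Delta(a)}-n_{\Delta(b)}$, $n_{\Delta(bc)}=n_{\Delta(b)}-n_{\Delta(c)}$, $n_{\Delta(ca)}=n_{\Delta(c)}-n_{\Delta(a)}$; (2) whenever the side $k$ of $\Delta$ is the short side $k$ of $F$, and $\{k,l,m\}=\{ab,bc,ca\}$: $n_{\Delta(k)}=n_{F(k)}+n_{F(k,l)}+n_{F(k,m)}$; (3) for glued short sides $k,\widehat k$ of glued hexagons $F,\widehat F$: $n_{F(k)}+n_{\widehat F(\widehat k)}=0$; (4) for glued hexagons $F,\widehat F$ and $k\ne l$: $n_{F(k,l)}+n_{\widehat F(\widehat k,\widehat l)}=n_{F(l,k)}+n_{\widehat F(\widehat l,\widehat k)}$. **Intersection number.** Put $\epsilon_{k,l}=1$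 if $(k,l)\in\{(a,b),(b,c),(c,a),(ab,bc),(bc,ca),(ca,ab)\}$, $\epsilon_{k,l}=-1$ if $(l,k)$ is in this set, and $0$ otherwise. Define an antisymmetric bilinear pairing on branches by $\gamma_{\Delta(x)}\cdot\gamma_{\Delta(y)}=\epsilon_{x,y}$ for $x,y\in\{a,b,c\}$; $\gamma_{F(k)}\cdot\gamma_{F(k,l)}=\epsilon_{k,l}$; $\gamma_{F(k,l)}\cdot\gamma_{F(k,m)}=-\epsilon_{l,m}$; $\gamma_{F(k,l)}\cdot\gamma_{F(l,k)}=\epsilon_{k,l}$; all other pairings of branches (not obtained from these by antisymmetry) being $0$. For $\zeta=\sum n_\gamma\gamma$, $\zeta'=\sum n'_\gamma\gamma$, the intersection number $\zeta\cdot\zeta'$ is defined by $2\zeta\cdot\zeta'=(\sum n_\gamma\gamma)\cdot(\sum n'_\gamma\gamma)$. **Symplectic space and holonomy.** $\mathcal V$ is the $2n$-dimensional real vector space generated by $\mathbf a_i,\mathbf b_i,\mathbf c_i$ ($1\le i\le n$) subject to $\mathbf a_i+\mathbf b_i+\mathbf c_i=0$, with the symplectic form $\omega(\mathbf a_i,\mathbf b_j)=\omega(\mathbf b_i,\mathbf c_j)=\omega(\mathbf c_i,\mathbf a_j)=\delta_{ij}$. The combinatorial holonomy is $h(\zeta)=\sum n_\gamma h(\gamma)\in\mathcal V$, where $h(\gamma_{\Delta(a)})=\mathbf a_i$, $h(\gamma_{\Delta(b)})=\mathbf b_i$, $h(\gamma_{\Delta(c)})=\mathbf c_i$ if $\Delta$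 is a triangular face of the truncated $t_i$, and $h(\gamma)=0$ for all other branches. *)

(* Defs.v *)
From HB Require Import structures.
From mathcomp Require Import all_boot all_order all_algebra all_fingroup.
From mathcomp Require Import reals.

Set Implicit Arguments.
Unset Strict Implicit.
Unset Printing Implicit Defensive.

Import GRing.Theory Num.Theory.
Local Open Scope ring_scope.

(* Labels a, b, c of edges of a tetrahedron (and of corners of triangles), and
   labels ab, bc, ca of sides of triangles (and of short sides of hexagons). *)

Inductive elabel := La | Lb | Lc.
Inductive slabel := Sab | Sbc | Sca.

Definition ord_of_elabel (x : elabel) : 'I_3 :=
  match x with La => @Ordinal 3 0 isT | Lb => @Ordinal 3 1 isT | Lc => @Ordinal 3 2 isT end.
Definition elabel_of_ord (i : 'I_3) : elabel :=
  match val i with 0%N => La | 1%N => Lb | _ => Lc end.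
Lemma ord_of_elabelK : cancel ord_of_elabel elabel_of_ord.
Proof. by case. Qed.
HB.instance Definition _ := Finite.copy elabel (can_type ord_of_elabelK).

Definition ord_of_slabel (k : slabel) : 'I_3 :=
  match k with Sab => @Ordinal 3 0 isT | Sbc => @Ordinal 3 1 isT | Sca => @Ordinal 3 2 isT end.
Definition slabel_of_ord (i : 'I_3) : slabel :=
  match val i with 0%N => Sab | 1%N => Sbc | _ => Sca end.
Lemma ord_of_slabelK : cancel ord_of_slabel slabel_of_ord.
Proof. by case. Qed.
HB.instance Definition _ := Finite.copy slabel (can_type ord_of_slabelK).

Definition epsE (x y : elabel) : int :=
  match x, y with
  | La, Lb | Lb, Lc | Lc, La => 1
  | Lb, La | Lc, Lb | La, Lc => -1
  | _, _ => 0
  end.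

Definition epsS (k l : slabel) : int :=
  match k, l with
  | Sab, Sbc | Sbc, Sca | Sca, Sab => 1
  | Sbc, Sab | Sca, Sbc | Sab, Sca => -1
  | _, _ => 0
  end.

(* The vertices of each oriented tetrahedron are numbered 0, 1, 2, 3 so that
   1, 2, 3 appear in anticlockwise order when viewed from outside at vertex 0;
   more generally p, q, r are in anticlockwise order viewed from outside at v
   iff (v, p, q, r) is an even permutation of (0, 1, 2, 3).  The face opposite
   vertex f, and the hexagon in it, are also indexed by f. *)

(* Any labelling of the edges such that opposite edges have the same label and
   the edges at each vertex are a, b, c in anticlockwise order viewed from
   outside has this form for a suitable numbering of the vertices as above.
   The value for u = v is irrelevant. *)
Definition edge_label (u v : 'I_4) : elabel :=
  match val u, val v with
  | 0%N, 1%N | 1%N, 0%N | 2%N, 3%N | 3%N, 2%N => La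
  | 0%N, 2%N | 2%N, 0%N | 1%N, 3%N | 3%N, 1%N => Lb
  | _, _ => Lc
  end.

Definition side_between (x y : elabel) : slabel :=
  match x, y with
  | La, Lb | Lb, La => Sab
  | Lb, Lc | Lc, Lb => Sbc
  | _, _ => Sca
  end.

Definition opposite_side (x : elabel) : slabel :=
  match x with La => Sbc | Lb => Sca | Lc => Sab end.

(* For v != f, the label of the segment in which the triangle at vertex v meets
   the face opposite f: it joins the two corners of the triangle other than the
   one on the edge vf. *)
Definition side_label (v f : 'I_4) : slabel := opposite_side (edge_label v f).

Lemma epsE_edge_label_tperm (x y p q r : 'I_4) :
  x != y -> uniq [:: p; q; r] ->
  let t := tperm x y in
  epsE (edge_label (t p) (t q)) (edge_label (t p) (t r)) =
  - epsE (edge_label p q) (edge_label p r).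
Proof.
move=> xy pqr t; rewrite /t !permE /= {t}; move: x y p q r xy pqr.
by do 5![case=> [[|[|[|[|//]]]] ?] //].
Qed.

Lemma epsE_edge_label_perm (s : 'S_4) (p q r : 'I_4) : uniq [:: p; q; r] ->
  epsE (edge_label (s p) (s q)) (edge_label (s p) (s r)) =
  (-1) ^+ s * epsE (edge_label p q) (edge_label p r).
Proof.
have [ts -> dts] := prod_tpermP s; rewrite odd_perm_prod //.
elim: ts dts p q r => [_ p q r _|t ts IH /= /andP[dt dts] p q r pqr].
  by rewrite big_nil !perm1 expr0 mul1r.
rewrite big_cons !permM IH //; last first.
  by have /= -> := map_inj_uniq (@perm_inj _ (tperm t.1 t.2)) [:: p; q; r].
rewrite epsE_edge_label_tperm //.
by case: (odd _); rewrite /= ?expr0 ?expr1 ?mul1r ?mulN1r ?opprK.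
Qed.

Lemma edge_label_anticlockwise (s : 'S_4) : ~~ odd_perm s ->
  let x i := edge_label (s (inord 0)) (s (inord i)) in
  (x 1%N, x 2%N, x 3%N) \in [:: (La, Lb, Lc); (Lb, Lc, La); (Lc, La, Lb)].
Proof.
move=> /negbTE s0; set x := fun i : nat => edge_label _ _; rewrite /=.
have E i j : uniq [:: inord 0; inord i; inord j : 'I_4] ->
    epsE (x i) (x j) = epsE (edge_label (inord 0) (inord i))
                            (edge_label (inord 0) (inord j)).
  by move=> u; rewrite /x epsE_edge_label_perm // s0 expr0 mul1r.
have I i : (i < 4)%N -> val (inord i : 'I_4) = i by move=> ?; rewrite /= inordK.
have := E 1%N 2%N; have := E 2%N 3%N.
rewrite /= !inE -!(inj_eq val_inj) /edge_label !I // => /(_ isT) + /(_ isT).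
by case: (x 1%N) (x 2%N) (x 3%N) => [] [] [].
Qed.

Lemma side_labelE (v f p q : 'I_4) : uniq [:: v; f; p; q] ->
  side_label v f = side_between (edge_label v p) (edge_label v q).
Proof.
by case: v f p q => [[|[|[|[|//]]]] ?] [[|[|[|[|//]]]] ?]
  [[|[|[|[|//]]]] ?] [[|[|[|[|//]]]] ?].
Qed.

(* An oriented ideal triangulation, as gluing data for the 4n faces of n
   oriented tetrahedra.  The face F = (i, f) of t_i opposite vertex f is glued
   to a face of t_(nbr F); the gluing map is recorded by its action on the
   three vertices of F, extended to all four vertices by sending f to the
   vertex opposite the image face.  Since all tetrahedra are oriented, the
   gluing map reverses orientation iff this permutation is odd. *)
Record triangulation (n : nat) := Triangulation {
  nbr : 'I_n * 'I_4 -> 'I_n;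
  gluing : 'I_n * 'I_4 -> 'S_4;
  glued (F : 'I_n * 'I_4) : 'I_n * 'I_4 := (nbr F, gluing F F.2);
  gluing_odd : forall F, odd_perm (gluing F);
  glued_neq : forall F, glued F != F;
  nbr_glued : forall F, nbr (glued F) = F.1;
  gluing_glued : forall F, gluing (glued F) = (gluing F)^-1%g
}.

(* The vertex of the face opposite f at which its short side k lies. *)
Definition short_side_vertex (f : 'I_4) (k : slabel) : 'I_4 :=
  odflt f [pick v | (v != f) && (side_label v f == k)].

Definition hat (n : nat) (T : triangulation n) (F : 'I_n * 'I_4) (k : slabel)
  : slabel :=
  side_label (gluing T F (short_side_vertex F.2 k)) (gluing T F F.2).

Lemma side_label_inj (f u v : 'I_4) : u != f -> v != f ->
  side_label u f = side_label v f -> u = v.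
Proof.
case: f u v => [[|[|[|[|//]]]] ?] [[|[|[|[|//]]]] ?] [[|[|[|[|//]]]] ?] //;
  by move=> _ _ // _; apply: val_inj.
Qed.

Lemma short_side_vertexP (f : 'I_4) (k : slabel) :
  short_side_vertex f k != f /\ side_label (short_side_vertex f k) f = k.
Proof.
rewrite /short_side_vertex; case: pickP => [v /andP[vf /eqP] // | none].
suff [v /andP[vf /eqP kv]] : exists v : 'I_4, (v != f) && (side_label v f == k).
  by move: (none v); rewrite vf kv eqxx.
case: f k {none} => [[|[|[|[|//]]]] lt4] [];
  solve [by exists (@Ordinal 4 0 isT) | by exists (@Ordinal 4 1 isT)
       | by exists (@Ordinal 4 2 isT) | by exists (@Ordinal 4 3 isT)].
Qed.

Lemma hat_neq (n : nat) (T : triangulation n) (F : 'I_n * 'I_4) (k l : slabel) :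
  k != l -> hat T F k != hat T F l.
Proof.
apply: contra_neq.
have [kf kE] := short_side_vertexP F.2 k.
have [lf lE] := short_side_vertexP F.2 l.
move=> /side_label_inj H; rewrite -kE -lE; congr (side_label _ _).
by apply: (@perm_inj _ (gluing T F)); apply: H; rewrite (inj_eq perm_inj).
Qed.

Lemma hat_reverses (n : nat) (T : triangulation n) (F : 'I_n * 'I_4)
    (k l : slabel) : epsS (hat T F k) (hat T F l) = - epsS k l.
Proof.
have [->|kl] := eqVneq k l; first by case: (hat T F l); case: l.
have [kf kE] := short_side_vertexP F.2 k.
have [lf lE] := short_side_vertexP F.2 l.
have epsSE u v f : epsS (side_label u f) (side_label v f) =
    epsE (edge_label f u) (edge_label f v).
  rewrite /side_label; have C w : edge_label w f = edge_label f w.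
    by case: w f => [[|[|[|[|//]]]] ?] [[|[|[|[|//]]]] ?].
  by rewrite !C; case: edge_label; case: edge_label.
rewrite -{2}kE -{2}lE /hat !epsSE epsE_edge_label_perm ?gluing_odd ?mulN1r //.
rewrite /= !inE negb_or !(eq_sym F.2) kf lf /= andbT.
by apply: contra_neq kl => uv; rewrite -kE -lE uv.
Qed.

(* Triangles and hexagons are both indexed by 'I_n * 'I_4: (i, v) is the
   triangle of t_i at vertex v, (i, f) the hexagon opposite vertex f.
   Corner, Cross, Short and Long are the branches gamma_Delta(x),
   gamma_Delta(k), gamma_F(k) and gamma_F(k,l). *)
Inductive branch (n : nat) :=
| Corner of 'I_n * 'I_4 & elabel
| Cross of 'I_n * 'I_4 & slabel
| Short of 'I_n * 'I_4 & slabel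
| Long (F : 'I_n * 'I_4) (k l : slabel) of k != l.

Definition branch_codes (n : nat) : Type :=
  ('I_n * 'I_4) * (elabel + slabel + slabel
    + {kl : slabel * slabel | kl.1 != kl.2}).
Definition branch_code (n : nat) (g : branch n) : branch_codes n :=
  match g with
  | Corner D x => (D, inl (inl (inl x)))
  | Cross D k => (D, inl (inl (inr k)))
  | Short F k => (F, inl (inr k))
  | Long F k l kl => (F, inr (exist _ (k, l) kl))
  end.
Definition branch_decode (n : nat) (u : branch_codes n) : branch n :=
  match u with
  | (D, inl (inl (inl x))) => Corner D x
  | (D, inl (inl (inr k))) => Cross D k
  | (F, inl (inr k)) => Short F k
  | (F, inr (exist kl H)) => @Long n F kl.1 kl.2 H
  end.
Lemma branch_codeK (n : nat) : cancel (@branch_code n) (@branch_decode n).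
Proof. by case. Qed.
HB.instance Definition _ (n : nat) :=
  Finite.copy (branch n) (can_type (@branch_codeK n)).

Record oscillating (n : nat) (T : triangulation n) (z : branch n -> int)
  : Prop := Oscillating {
  osc_triangle : forall D,
    [/\ z (Cross D Sab) = z (Corner D La) - z (Corner D Lb),
        z (Cross D Sbc) = z (Corner D Lb) - z (Corner D Lc)
      & z (Cross D Sca) = z (Corner D Lc) - z (Corner D La)];
  osc_side : forall (i : 'I_n) (v f : 'I_4) (k l m : slabel)
      (kl : k != l) (km : k != m),
    v != f -> k = side_label v f -> l != m ->
    z (Cross (i, v) k) =
      z (Short (i, f) k) + z (Long (i, f) kl) + z (Long (i, f) km);
  osc_short : forall F k,
    z (Short F k) + z (Short (glued T F) (hat T F k)) = 0;
  osc_long : forall F (k l : slabel) (kl : k != l) (lk : l != k),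
    z (Long F kl) + z (Long (glued T F) (hat_neq T F kl)) =
    z (Long F lk) + z (Long (glued T F) (hat_neq T F lk))
}.

Definition branch_pairing (n : nat) (g g' : branch n) : int :=
  match g, g' with
  | Corner D x, Corner D' y => if D == D' then epsE x y else 0
  | Short F k, Long F' k' l _ =>
      if (F == F') && (k == k') then epsS k l else 0
  | Long F k l _, Short F' k' =>
      if (F == F') && (k == k') then - epsS k l else 0
  | Long F k l _, Long F' k' l' _ =>
      if F != F' then 0
      else if k == k' then - epsS l l'
      else if (k == l') && (l == k') then epsS k l
      else 0
  | _, _ => 0
  end.

Lemma branch_pairing_antisym (n : nat) (g g' : branch n) :
  branch_pairing g' g = - branch_pairing g g'.
Proof.
have epsEC x y : epsE y x = - epsE x y by case: x y => [] [].
have epsSC k l : epsS l k = - epsS k l by case: k l => [] [].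
case: g g' => [D x|D k|F k|F k l kl] [D' x'|D' k'|F' k'|F' k' l' kl'] //=;
  rewrite ?oppr0 //.
- by rewrite eq_sym epsEC; case: ifP; rewrite ?oppr0.
- by rewrite eq_sym (eq_sym k'); case: ifP => [/andP[_ /eqP->]|]; rewrite ?oppr0.
- rewrite eq_sym (eq_sym k'); case: ifP => [/andP[_ /eqP->]|];
    by rewrite ?opprK ?oppr0.
rewrite eq_sym; case: ifP => _; rewrite ?oppr0 // (eq_sym k').
case: ifP => _; first by rewrite epsSC.
rewrite (eq_sym k') (eq_sym l') andbC.
by case: ifP => [/andP[/eqP-> /eqP->]|_] //; rewrite oppr0.
Qed.

Definition pairing (n : nat) (z z' : branch n -> int) : int :=
  \sum_(g : branch n) \sum_(g' : branch n) z g * z' g' * branch_pairing g g'.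

Definition intersection_number (R : realType) (n : nat)
  (z z' : branch n -> int) : R := (pairing z z')%:~R / 2.

(* The 2n-dimensional space generated by a_i, b_i, c_i with a_i + b_i + c_i = 0,
   in coordinates with respect to the basis (a_i, b_i); NZgen_presentation
   below is its universal property. *)
Definition NZspace (R : realType) (n : nat) := 'M[R]_(n, 2).

Definition NZgen (R : realType) (n : nat) (i : 'I_n) (x : elabel)
  : NZspace R n :=
  match x with
  | La => delta_mx i 0
  | Lb => delta_mx i 1
  | Lc => - delta_mx i 0 - delta_mx i 1
  end.

Definition omega (R : realType) (n : nat) (u v : NZspace R n) : R :=
  \sum_(i < n) (u i 0 * v i 1 - u i 1 * v i 0).

Lemma NZgen_sum (R : realType) (n : nat) (i : 'I_n) :
  NZgen R i La + NZgen R i Lb + NZgen R i Lc = 0.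
Proof. by rewrite /= -opprD subrr. Qed.

Lemma NZgen_presentation (R : realType) (n : nat) (W : lmodType R)
    (w : 'I_n -> elabel -> W) :
  (forall i, w i La + w i Lb + w i Lc = 0) ->
  exists2 f : {linear 'M[R]_(n, 2) -> W},
    forall i x, f (NZgen R i x) = w i x
  & forall f' : {linear 'M[R]_(n, 2) -> W},
      (forall i x, f' (NZgen R i x) = w i x) -> f' =1 f.
Proof.
move=> w0; pose f (u : 'M[R]_(n, 2)) : W :=
  \sum_(i < n) (u i 0 *: w i La + u i 1 *: w i Lb).
have fL : linear f.
  move=> a u v; rewrite /f scaler_sumr -big_split; apply: eq_bigr => i _ /=.
  by rewrite !mxE scalerDr !scalerDl !scalerA addrACA.
pose fM := GRing.isLinear.Build R _ _ _ f fL.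
pose F : {linear 'M[R]_(n, 2) -> W} := HB.pack f fM.
have Fa i : F (NZgen R i La) = w i La.
  rewrite /= /f (bigD1 i) //= big1 => [|j ji]; rewrite !mxE ?eqxx ?(negbTE ji) /=.
    by rewrite scale1r scale0r !addr0.
  by rewrite !scale0r addr0.
have Fb i : F (NZgen R i Lb) = w i Lb.
  rewrite /= /f (bigD1 i) //= big1 => [|j ji]; rewrite !mxE ?eqxx ?(negbTE ji) /=.
    by rewrite scale1r scale0r add0r addr0.
  by rewrite !scale0r addr0.
have wc i : w i Lc = - w i La - w i Lb.
  by apply/eqP; rewrite -opprD -addr_eq0 addrC w0.
exists F => [i [] //|f' f'E u]; first by rewrite wc -Fa -Fb -raddfN -raddfB.
rewrite {1}[u]matrix_sum_delta linear_sum; apply: eq_bigr => i _.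
rewrite big_ord_recl big_ord1 linearD !linearZ /=.
have -> : lift ord0 ord0 = 1 :> 'I_2 by apply: val_inj.
by rewrite (f'E i La) (f'E i Lb).
Qed.

Lemma omega_gen (R : realType) (n : nat) (i j : 'I_n) (x y : elabel) :
  omega (NZgen R i x) (NZgen R j y) = (epsE x y)%:~R * (i == j)%:R.
Proof.
rewrite /omega (bigD1 i) //= big1 => [|k /negbTE ki].
  rewrite addr0; case: x y => [] [] /=; rewrite !mxE !eqxx /=; case: (i == j);
    by rewrite /= ?(mulr0, mul0r, mulr1, mul1r, subr0, sub0r, oppr0, mulN1r,
                    mulrN1, opprK, addr0, add0r, subrr, mulr0z).
case: x y => [] [] /=; rewrite !mxE !ki /=;
  by rewrite ?(mulr0, mul0r, mulr1, mul1r, subr0, sub0r, oppr0, addr0, subrr).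
Qed.

Definition branch_holonomy (R : realType) (n : nat) (g : branch n)
  : NZspace R n :=
  match g with Corner D x => NZgen R D.1 x | _ => 0 end.

Definition holonomy (R : realType) (n : nat) (z : branch n -> int)
  : NZspace R n := \sum_(g : branch n) (z g)%:~R *: branch_holonomy R g.

(* Main.v *)
(** Within a tetrahedron, [omega] pairs the corner coefficients of every two
    triangles.  The diagonal terms form the triangle part of the intersection
    pairing.  Two distinct triangles, at vertices [v] and [w], are joined by the
    edge [vw]; their corner pairing depends only on the coefficients crossing
    the sides of the triangles, and splits into one term for each of the two
    faces along this edge.  Regrouped by faces, the off-diagonal terms of a
    hexagon [F] add up to the antisymmetric pairing of the flows across its
    short sides.  This differs from the hexagon part of the intersection pairing
    by a defect which involves a curve only through its coefficients on the
    branches [Short F k] and its net flow along each long side of [F].  Gluing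
    negates the former, preserves the latter and reverses [epsS], hence changes
    the sign of the defect, so the defects of glued hexagons cancel. *)
Require Import Defs.
From HB Require Import structures.
From mathcomp Require Import all_boot all_order all_algebra all_fingroup.
From mathcomp Require Import reals ring.

Set Implicit Arguments.
Unset Strict Implicit.
Unset Printing Implicit Defensive.

Import GRing.Theory Num.Theory.
Local Open Scope ring_scope.

Lemma sum_exhaustive (I : finType) (V : nmodType) (s : seq I) (f : I -> V) :
  uniq s -> (forall i, i \in s) -> \sum_i f i = \sum_(i <- s) f i.
Proof.
by move=> s_uniq sI; rewrite [RHS]big_uniq //=; apply: eq_bigl => i; rewrite sI.
Qed.

Lemma sum_elabel (V : nmodType) (f : elabel -> V) :
  \sum_x f x = f La + f Lb + f Lc.
Proof.
rewrite (@sum_exhaustive _ _ [:: La; Lb; Lc]) //; last by case.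
by rewrite !big_cons big_nil addr0 addrA.
Qed.

Lemma sum_slabel (V : nmodType) (f : slabel -> V) :
  \sum_k f k = f Sab + f Sbc + f Sca.
Proof.
rewrite (@sum_exhaustive _ _ [:: Sab; Sbc; Sca]) //; last by case.
by rewrite !big_cons big_nil addr0 addrA.
Qed.

Lemma sum_antisym_eq0 (I : finType) (R : numDomainType) (P : pred I)
    (f : I -> I -> R) :
  (forall i j, f j i = - f i j) -> \sum_(i | P i) \sum_(j | P j) f i j = 0.
Proof.
move=> fN; apply/eqP; rewrite -eqNr -sumrN exchange_big /=; apply/eqP.
by apply: eq_bigr => i _; rewrite -sumrN; apply: eq_bigr => j _; rewrite -fN.
Qed.

Lemma sum_oppr_inj_eq0 (I : finType) (R : numDomainType) (h : I -> I)
    (f : I -> R) :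
  injective h -> (forall i, f (h i) = - f i) -> \sum_i f i = 0.
Proof.
move=> h_inj fN; apply/eqP; rewrite -eqNr -sumrN [eqbRHS](reindex_inj h_inj).
by apply/eqP/eq_bigr => i _; rewrite fN.
Qed.

Lemma epsS_antisym k l : epsS l k = - epsS k l.
Proof. by case: k l => [] []. Qed.

Lemma epsS_diag k : epsS k k = 0.
Proof. by case: k. Qed.

Lemma epsS_opposite_side x y :
  epsS (opposite_side x) (opposite_side y) = epsE x y.
Proof. by case: x y => [] []. Qed.

Lemma sum_faces_around_edge (V : nmodType) (v w : 'I_4)
    (f : elabel -> elabel -> V) :
  (forall x, f x x = 0) -> v != w ->
  \sum_(p | (p != v) && (p != w)) f (edge_label v p) (edge_label w p) =
  \sum_(x | x != edge_label v w) \sum_(y | y != edge_label v w) f x y.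
Proof.
move=> f0 vw; under [RHS]eq_bigr do rewrite big_mkcond sum_elabel.
rewrite big_mkcond [RHS]big_mkcond sum_elabel !big_ord_recr big_ord0 /= add0r.
by case: v w vw => [[|[|[|[|//]]]] ?] [[|[|[|[|//]]]] ?] // _;
  rewrite /edge_label /= ?f0 ?add0r ?addr0 // addrC.
Qed.

Lemma sum_short_sides (V : nmodType) (p : 'I_4) (f : slabel -> V) :
  \sum_k f k = \sum_(v | v != p) f (side_label v p).
Proof.
rewrite (reindex_onto (side_label^~ p) (short_side_vertex p)) => [|k _] /=.
  apply: eq_bigl => v; have [sp sE] := short_side_vertexP p (side_label v p).
  by apply/eqP/idP => [<- //|vp]; apply: (side_label_inj sp).
by have [] := short_side_vertexP p k.
Qed.

Section OmegaBilinear.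
Variables (R : realType) (n : nat).

Fact omega_bilinear :
  bilinear_for *%R *%R (@omega R n : 'M_(n, 2) -> 'M_(n, 2) -> R).
Proof.
split=> u a v w; rewrite /omega /= mulr_sumr -big_split /=;
  by apply: eq_bigr => i _; rewrite !mxE; ring.
Qed.

HB.instance Definition _ :=
  bilinear_isBilinear.Build R 'M[R]_(n, 2) 'M[R]_(n, 2) R *%R *%R
    (@omega R n) omega_bilinear.

Lemma omega_sum (I J : finType) (u : I -> NZspace R n) (v : J -> NZspace R n) :
  omega (\sum_i u i) (\sum_j v j) = \sum_i \sum_j omega (u i) (v j).
Proof.
by rewrite linear_sumlz; apply: eq_bigr => i _; exact: linear_sumr.
Qed.

End OmegaBilinear.

Section Branches.
Variable n : nat.
Implicit Types (D F : 'I_n * 'I_4) (z : branch n -> int).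

Definition side_pair : Type := {kl : slabel * slabel | kl.1 != kl.2}.

Definition long_branch F (u : side_pair) : branch n :=
  let: exist _ kl := u in Long F kl.

Definition branch_cell (g : branch n) : 'I_n * 'I_4 :=
  match g with Corner D _ | Cross D _ | Short D _ | @Long _ D _ _ _ => D end.

Lemma sum_branches (V : nmodType) (f : branch n -> V) :
  \sum_g f g = \sum_D (\sum_x f (Corner D x) + \sum_k f (Cross D k)
                       + \sum_k f (Short D k) + \sum_u f (long_branch D u)).
Proof.
transitivity (\sum_D \sum_(c : elabel + slabel + slabel + side_pair)
                f (branch_decode (D, c))); last first.
  by apply: eq_bigr => D _; rewrite !big_sumType.
rewrite pair_bigA (reindex (fun p => branch_decode (p.1, p.2))) //=.
exists (@branch_code n); first by case=> D [[[x|k]|k]|[[k l] kl]].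
by case.
Qed.

(* Extends the coefficients of the branches [Long F kl] by 0 to [k = l]. *)
Definition long_coef z F (k l : slabel) : int :=
  if insub (k, l) is Some u then z (long_branch F u) else 0.

Lemma long_coef_diag z F k : long_coef z F k k = 0.
Proof. by rewrite /long_coef insubF //= eqxx. Qed.

Lemma long_coef_val z F (u : side_pair) :
  long_coef z F (val u).1 (val u).2 = z (long_branch F u).
Proof. by rewrite /long_coef -surjective_pairing valK. Qed.

Lemma long_coefE z F k l (kl : k != l) : long_coef z F k l = z (Long F kl).
Proof. exact: (long_coef_val z F (exist _ (k, l) kl)). Qed.

Lemma sum_long_branches z F (f : slabel -> slabel -> int) :
  \sum_u z (long_branch F u) * f (val u).1 (val u).2 =
  \sum_k \sum_l long_coef z F k l * f k l.
Proof.
rewrite pair_bigA /=.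
under eq_bigr do rewrite -long_coef_val.
rewrite -(big_sub [pred kl : slabel * slabel | kl.1 != kl.2]
            (fun kl => long_coef z F kl.1 kl.2 * f kl.1 kl.2)) big_mkcond.
apply: eq_bigr => -[k l] _; rewrite inE /=.
by have [->|//] := eqVneq k l; rewrite long_coef_diag mul0r.
Qed.

Definition corner_pairing z z' D D' : int :=
  \sum_x \sum_y epsE x y * z (Corner D x) * z' (Corner D' y).

Definition hexagon_pairing z z' F : int :=
  \sum_k \sum_l epsS k l *
    (z (Short F k) * long_coef z' F k l - long_coef z F k l * z' (Short F k)
     + long_coef z F k l * long_coef z' F l k)
  - \sum_k \sum_l \sum_m epsS l m * long_coef z F k l * long_coef z' F k m.

Lemma branch_pairing_cell (g g' : branch n) :
  branch_cell g' != branch_cell g -> branch_pairing g g' = 0.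
Proof.
by case: g g' => [D x|D k|F k|F k l kl] [D' x'|D' k'|F' k'|F' k' l' kl'] //=;
  rewrite eq_sym => /negbTE ->.
Qed.

Lemma sum_pairing_cell z g :
  let D := branch_cell g in
  \sum_g' z g' * branch_pairing g g' =
  \sum_x z (Corner D x) * branch_pairing g (Corner D x)
  + \sum_k z (Cross D k) * branch_pairing g (Cross D k)
  + \sum_k z (Short D k) * branch_pairing g (Short D k)
  + \sum_u z (long_branch D u) * branch_pairing g (long_branch D u).
Proof.
rewrite /= sum_branches (bigD1 (branch_cell g)) //=.
rewrite [X in _ + X]big1 ?addr0 // => D Dg.
rewrite !big1 ?addr0 // => u _; rewrite branch_pairing_cell ?mulr0 //.
by case: u.
Qed.

Lemma sum_pairing_corner z D x :
  \sum_g z g * branch_pairing (Corner D x) g =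
  \sum_y epsE x y * z (Corner D y).
Proof.
rewrite sum_pairing_cell /= -!addrA -[RHS]addr0; congr (_ + _).
  by apply: eq_bigr => y _; rewrite /= eqxx mulrC.
by rewrite !big1 ?addr0 // => [[]|k|k] *; rewrite mulr0.
Qed.

Lemma sum_pairing_short z F k :
  \sum_g z g * branch_pairing (Short F k) g =
  \sum_l epsS k l * long_coef z F k l.
Proof.
rewrite sum_pairing_cell /= -[RHS]add0r; congr (_ + _).
  by rewrite !big1 ?addr0 // => *; rewrite mulr0.
transitivity (\sum_u z (long_branch F u)
                * (if k == (val u).1 then epsS k (val u).2 else 0)).
  by apply: eq_bigr => -[[k' l] kl] _ /=; rewrite eqxx; case: eqP => // ->.
rewrite (sum_long_branches z F (fun k' l => if k == k' then epsS k l else 0)).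
by case: k; rewrite !sum_slabel /=; ring.
Qed.

Lemma sum_pairing_long z F (u : side_pair) :
  \sum_g z g * branch_pairing (long_branch F u) g =
  let k := (val u).1 in let l := (val u).2 in
  epsS k l * (long_coef z F l k - z (Short F k))
  - \sum_m epsS l m * long_coef z F k m.
Proof.
case: u => -[k l] kl; rewrite sum_pairing_cell /=.
rewrite [X in X + _ + _](_ : _ = 0) ?add0r; last first.
  by rewrite !big1 ?addr0 // => *; rewrite mulr0.
rewrite (bigD1 k) //= !eqxx /= big1 ?addr0 => [|k' k'k]; last first.
  by rewrite eq_sym (negbTE k'k) mulr0.
transitivity (z (Short F k) * - epsS k l + \sum_u z (long_branch F u)
    * (if k == (val u).1 then - epsS l (val u).2
       else if (k == (val u).2) && (l == (val u).1) then epsS k l else 0)).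
  by congr (_ + _); apply: eq_bigr => -[[k' l'] kl'] _ /=; rewrite eqxx.
rewrite (sum_long_branches z F (fun k' l' => if k == k' then - epsS l l'
  else if (k == l') && (l == k') then epsS k l else 0)).
by case: k l kl => [] [] // _; rewrite !sum_slabel /=; ring.
Qed.

Lemma pairing_cells z z' :
  pairing z z' = \sum_D (corner_pairing z z' D D + hexagon_pairing z z' D).
Proof.
rewrite /pairing; under eq_bigr do
  (under eq_bigr do rewrite -mulrA; rewrite -mulr_sumr).
rewrite sum_branches; apply: eq_bigr => D _; rewrite -!addrA; congr (_ + _).
  apply: eq_bigr => x _; rewrite sum_pairing_corner mulr_sumr.
  by apply: eq_bigr => y _; rewrite mulrCA mulrA.
rewrite big1 ?add0r => [|k _]; last first.
  by rewrite big1 ?mulr0 // => g _; apply: mulr0.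
under eq_bigr do rewrite sum_pairing_short.
under [X in _ + X]eq_bigr do rewrite sum_pairing_long /=.
rewrite (sum_long_branches z D (fun k l =>
  epsS k l * (long_coef z' D l k - z' (Short D k))
  - \sum_m epsS l m * long_coef z' D k m)).
by rewrite /hexagon_pairing !sum_slabel; ring.
Qed.

Lemma sum_cells (V : nmodType) (f : 'I_n * 'I_4 -> V) :
  \sum_D f D = \sum_i \sum_v f (i, v).
Proof. by rewrite pair_bigA; apply: eq_bigr => -[]. Qed.

Definition triangle_holonomy (R : realType) z D : NZspace R n :=
  \sum_x (z (Corner D x))%:~R *: NZgen R D.1 x.

Lemma holonomyE (R : realType) z :
  holonomy R z = \sum_D triangle_holonomy R z D.
Proof.
rewrite /holonomy sum_branches; apply: eq_bigr => D _.
rewrite -!addrA -[RHS]addr0; congr (_ + _).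
by rewrite !big1 ?addr0 // => [[]|k|k] *; rewrite scaler0.
Qed.

Lemma omega_triangle_holonomy (R : realType) z z' D D' :
  omega (triangle_holonomy R z D) (triangle_holonomy R z' D') =
  (corner_pairing z z' D D')%:~R * (D.1 == D'.1)%:R.
Proof.
rewrite omega_sum rmorph_sum mulr_suml; apply: eq_bigr => x _.
rewrite rmorph_sum mulr_suml; apply: eq_bigr => y _.
by rewrite linearZl linearZr /= omega_gen !rmorphM /=; ring.
Qed.

Lemma omega_holonomy (R : realType) z z' :
  omega (holonomy R z) (holonomy R z') =
  (\sum_i \sum_v \sum_w corner_pairing z z' (i, v) (i, w))%:~R.
Proof.
rewrite !holonomyE omega_sum sum_cells rmorph_sum; apply: eq_bigr => i _.
rewrite rmorph_sum; apply: eq_bigr => v _.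
rewrite sum_cells (bigD1 i) //= [X in _ + X]big1 => [|j ji].
  rewrite addr0 rmorph_sum; apply: eq_bigr => w _.
  by rewrite omega_triangle_holonomy eqxx mulr1.
by apply: big1 => w _; rewrite omega_triangle_holonomy eq_sym (negbTE ji) mulr0.
Qed.

Definition side_flow z F k : int := z (Short F k) + \sum_l long_coef z F k l.

(* The net flow along the long side of [F] facing the short side [k]. *)
Definition edge_flow z F k : int :=
  \sum_(l | l != k) \sum_(m | m != k) epsS l m * long_coef z F l m.

Definition side_flow_pairing z z' F : int :=
  \sum_k \sum_l epsS k l * side_flow z F k * side_flow z' F l.

Definition face_pairing z z' (i : 'I_n) (p v w : 'I_4) : int :=
  epsS (side_label v p) (side_label w p)
  * side_flow z (i, p) (side_label v p) * side_flow z' (i, p) (side_label w p).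

Lemma side_flow_pairing_vertices z z' i p :
  side_flow_pairing z z' (i, p) =
  \sum_(v | v != p) \sum_(w | w != p) face_pairing z z' i p v w.
Proof.
rewrite /side_flow_pairing (sum_short_sides p); apply: eq_bigr => v _.
exact: sum_short_sides.
Qed.

Definition hexagon_defect z z' F : int :=
  let twist w k := \sum_l edge_flow w F l - edge_flow w F k *+ 2 in
  \sum_k (z (Short F k) * twist z' k - twist z k * z' (Short F k))
  - \sum_k \sum_l epsS k l * (z (Short F k) * z' (Short F l)
                              + edge_flow z F k * edge_flow z' F l).

Lemma hexagon_pairingE z z' F :
  hexagon_pairing z z' F = side_flow_pairing z z' F + hexagon_defect z z' F.
Proof.
have edge_flowE w k : edge_flow w F k = \sum_l \sum_m
    (if (l != k) && (m != k) then epsS l m * long_coef w F l m else 0).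
  rewrite /edge_flow big_mkcond; apply: eq_bigr => l _.
  by rewrite big_mkcond; case: (l != k) => //=; rewrite big1.
rewrite /hexagon_defect /side_flow_pairing /hexagon_pairing /side_flow.
rewrite !sum_slabel !edge_flowE !sum_slabel /= !long_coef_diag; ring.
Qed.

Section Gluing.
Variable T : triangulation n.

Lemma gluedK : involutive (glued T).
Proof.
move=> F; rewrite {1}/glued gluing_glued nbr_glued /= permK.
by rewrite -surjective_pairing.
Qed.

Lemma hat_inj F : injective (hat T F).
Proof. by move=> k l; apply: contra_eq; apply: hat_neq. Qed.

Lemma sum_neq_hat (V : nmodType) F k (f : slabel -> V) :
  \sum_(l | l != hat T F k) f l = \sum_(l | l != k) f (hat T F l).
Proof.
rewrite (reindex_inj (@hat_inj F)); apply: eq_bigl => l.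
by rewrite (inj_eq (@hat_inj F)).
Qed.

Section OscillatingCurve.
Variable z : branch n -> int.
Hypothesis Hz : oscillating T z.

Lemma osc_side_flow i v p : v != p ->
  z (Cross (i, v) (side_label v p)) = side_flow z (i, p) (side_label v p).
Proof.
move=> vp; have side := osc_side Hz i _ _ vp erefl.
rewrite /side_flow sum_slabel.
case: (side_label v p) side => side; rewrite long_coef_diag.
- by rewrite (side Sbc Sca isT isT isT) -!long_coefE add0r addrA.
- by rewrite (side Sab Sca isT isT isT) -!long_coefE addr0 addrA.
- by rewrite (side Sab Sbc isT isT isT) -!long_coefE addr0 addrA.
Qed.

Lemma short_glued F k : z (Short (glued T F) (hat T F k)) = - z (Short F k).
Proof. by apply/eqP; rewrite -addr_eq0 addrC (osc_short Hz). Qed.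

Lemma long_coef_glued F k l :
  long_coef z F k l + long_coef z (glued T F) (hat T F k) (hat T F l) =
  long_coef z F l k + long_coef z (glued T F) (hat T F l) (hat T F k).
Proof.
have [->//|kl] := eqVneq k l; have lk : l != k by rewrite eq_sym.
by have := osc_long Hz F kl lk; rewrite -!long_coefE.
Qed.

Lemma edge_flow_glued F k :
  edge_flow z (glued T F) (hat T F k) = edge_flow z F k.
Proof.
rewrite /edge_flow sum_neq_hat; apply/esym/eqP; rewrite -subr_eq0 -sumrB.
rewrite -[eqbRHS](@sum_antisym_eq0 _ _ (fun l => l != k) (fun l m => epsS l m *
  (long_coef z F l m + long_coef z (glued T F) (hat T F l) (hat T F m)))).
  apply/eqP/eq_bigr => l _; rewrite sum_neq_hat -sumrB; apply: eq_bigr => m _.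
  by rewrite hat_reverses mulrDr mulNr opprK.
by move=> l m; rewrite long_coef_glued epsS_antisym mulNr.
Qed.

End OscillatingCurve.

Section OscillatingPair.
Variables z z' : branch n -> int.
Hypotheses (Hz : oscillating T z) (Hz' : oscillating T z').

Lemma hexagon_defect_glued F :
  hexagon_defect z z' (glued T F) = - hexagon_defect z z' F.
Proof.
have sum_edge_flow_glued w : oscillating T w ->
    \sum_l edge_flow w (glued T F) l = \sum_l edge_flow w F l.
  move=> Hw; rewrite (reindex_inj (@hat_inj F)).
  by apply: eq_bigr => l _; rewrite edge_flow_glued.
rewrite /hexagon_defect !sum_edge_flow_glued // opprD.
congr (_ - _); rewrite -sumrN (reindex_inj (@hat_inj F)).
  apply: eq_bigr => k _ /=.
  by rewrite !short_glued // !edge_flow_glued //; ring.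
apply: eq_bigr => k _ /=.
rewrite -sumrN (reindex_inj (@hat_inj F)); apply: eq_bigr => l _ /=.
by rewrite !short_glued // !edge_flow_glued // hat_reverses; ring.
Qed.

Lemma sum_hexagon_pairing_side_flow :
  \sum_F hexagon_pairing z z' F = \sum_F side_flow_pairing z z' F.
Proof.
under eq_bigr do rewrite hexagon_pairingE.
rewrite big_split /= -[RHS]addr0; congr (_ + _).
exact: sum_oppr_inj_eq0 (inv_inj gluedK) hexagon_defect_glued.
Qed.

(* The side coefficients of a triangle sum to 0, so those of the two sides
   adjacent to the corner [x] determine the pairing. *)
Lemma corner_pairing_sides D D' x :
  corner_pairing z z' D D' = \sum_(y | y != x) \sum_(w | w != x)
    epsE y w * z (Cross D (opposite_side y)) * z' (Cross D' (opposite_side w)).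
Proof.
have [ab bc ca] := osc_triangle Hz D; have [ab' bc' ca'] := osc_triangle Hz' D'.
under eq_bigr do rewrite big_mkcond sum_elabel.
rewrite /corner_pairing !(big_mkcond (fun y => y != x)) !sum_elabel /=.
by case: x; rewrite /= ?ab ?bc ?ca ?ab' ?bc' ?ca'; ring.
Qed.

Lemma corner_pairing_faces i v w : v != w ->
  corner_pairing z z' (i, v) (i, w) =
  \sum_(p | (p != v) && (p != w)) face_pairing z z' i p v w.
Proof.
move=> vw; rewrite (corner_pairing_sides _ _ (edge_label v w)).
rewrite -(@sum_faces_around_edge _ v w (fun x y =>
  epsE x y * z (Cross (i, v) (opposite_side x))
  * z' (Cross (i, w) (opposite_side y)))) //.
  apply: eq_bigr => p /andP[pv pw].
  rewrite /face_pairing -!osc_side_flow 1?eq_sym //.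
  by rewrite epsS_opposite_side.
by case; rewrite /= !mul0r.
Qed.

Lemma sum_corner_pairing_tetrahedron i :
  \sum_v \sum_w corner_pairing z z' (i, v) (i, w) =
  \sum_v (corner_pairing z z' (i, v) (i, v) + side_flow_pairing z z' (i, v)).
Proof.
have corner_split v : \sum_w corner_pairing z z' (i, v) (i, w) =
    corner_pairing z z' (i, v) (i, v)
    + \sum_w \sum_(p | (p != v) && (p != w)) face_pairing z z' i p v w.
  rewrite (bigD1 v) // [in RHS](bigD1 v) //= [X in _ = _ + (X + _)]big1 ?add0r.
    congr (_ + _); apply: eq_bigr => w wv.
    by rewrite corner_pairing_faces // eq_sym.
  by move=> p _; rewrite /face_pairing epsS_diag !mul0r.
under eq_bigr do rewrite corner_split.
rewrite !big_split; congr (_ + _).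
under [RHS]eq_bigr do rewrite side_flow_pairing_vertices.
rewrite [RHS](exchange_big_dep predT) //=; apply: eq_bigr => v _.
rewrite (exchange_big_dep (fun p => p != v)) => [|w p _ /andP[]//].
apply: eq_big => [p|p pv]; first by rewrite eq_sym.
by apply: eq_bigl => w; rewrite pv eq_sym.
Qed.

End OscillatingPair.
End Gluing.
End Branches.

Theorem theorem5p3 (R : realType) (n : nat) (n_gt0 : (0 < n)%N)
    (T : triangulation n) (zeta zeta' : branch n -> int)
    (Hzeta : oscillating T zeta) (Hzeta' : oscillating T zeta') :
  omega (holonomy R zeta) (holonomy R zeta') =
    2 * intersection_number R zeta zeta'.
Proof.
rewrite /intersection_number mulrCA mulfV ?mulr1 ?pnatr_eq0 // omega_holonomy.
congr _%:~R; rewrite pairing_cells big_split /=.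
rewrite (sum_hexagon_pairing_side_flow Hzeta Hzeta') -big_split sum_cells /=.
by apply: eq_bigr => i _; rewrite (sum_corner_pairing_tetrahedron Hzeta Hzeta').
Qed.
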